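(* Let $n\ge1$, $p\in\,]1,2[$ and $k_3>0$. Define $\phi_1,\phi_2:\mathbb{R}^n\to\mathbb{R}^n$ by $$\phi_1(e_1)=k_3e_1+(e_1^\top e_1)^{\frac{1-p}{3p-2}}e_1,$$ $$\phi_2(e_1)=k_3^2e_1+\frac{2k_3(2p-1)}{3p-2}(e_1^\top e_1)^{\frac{1-p}{3p-2}}e_1+\frac{p}{3p-2}(e_1^\top e_1)^{\frac{2(1-p)}{3p-2}}e_1$$ (with $\phi_1(0)=\phi_2(0)=0$). Let $k_1,k_2>0$ be such that the matrix $\mathcal{A}^*=\begin{bmatrix}-k_1&1\\-k_2&0\end{bmatrix}$ is Hurwitz. Then for the system $$\dot e_1=-k_1\phi_1(e_1)+e_2,\qquad \dot e_2=-k_2\phi_2(e_1),$$ with $(e_1,e_2)\in\mathbb{R}^n\times\mathbb{R}^n$, the state $(e_1^\top,e_2^\top)\in\mathbb{R}^{2n}$ converges to the origin in a fast finite-time stable manner, i.e. the origin is fast finite-time stable.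
   Context: An equilibrium (taken at the origin) of an ODE $\dot x=f(x)$ is finite-time stable if it is Lyapunov stable and every solution starting in a neighbourhood of it reaches it in finite time (settling time) and stays there. It is called fast finite-time stable (FFTS) if, in addition, convergence is governed by a positive definite function $V$ with $\dot V\le-\lambda_1V-\lambda_2V^{\alpha}$ for constants $\lambda_1,\lambda_2>0$, $\alpha\in\,]0,1[$, so that the settling time satisfies $T\le\frac{1}{\lambda_1(1-\alpha)}\ln\frac{\lambda_1V^{1-\alpha}(x_0)+\lambda_2}{\lambda_2}$. *)

(* Defs.v *)
From HB Require Import structures.
From mathcomp Require Import all_boot all_order all_algebra.
From mathcomp Require Import all_classical all_reals all_analysis.
From mathcomp Require Import complex.
Set Implicit Arguments. Unset Strict Implicit. Unset Printing Implicit Defensive.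
Import Order.TTheory GRing.Theory Num.Theory.
Import numFieldNormedType.Exports.
Local Open Scope classical_set_scope.
Local Open Scope ring_scope.

Definition hurwitz (R : rcfType) (m : nat) (A : 'M[R]_m) : Prop :=
  forall z : R[i], root (map_poly (fun c : R => Complex c 0) (char_poly A)) z ->
    complex.Re z < 0.

Definition Astar (R : ringType) (k1 k2 : R) : 'M[R]_2 :=
  \matrix_(i < 2, j < 2)
    (if (i == 0 :> nat) then (if (j == 0 :> nat) then - k1 else 1)
     else (if (j == 0 :> nat) then - k2 else 0)).

Definition dotv (R : ringType) (n : nat) (x y : 'rV[R]_n) : R :=
  \sum_(i < n) x 0 i * y 0 i.

Definition is_solution (R : realType) (X : normedModType R) (f : X -> X)
    (x : R -> X) : Prop :=
  (x t @[t --> 0^'+] --> x 0) /\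
  (forall t : R, 0 < t -> derivable x t 1 /\ 'D_1 x t = f (x t)).

Definition pos_def (R : realType) (X : normedModType R) (V : X -> R) : Prop :=
  V 0 = 0 /\ (forall z : X, z != 0 -> 0 < V z).

Definition lyap_stable (R : realType) (X : normedModType R) (f : X -> X) :=
  forall eps : R, 0 < eps -> exists2 delta : R, 0 < delta &
    forall x : R -> X, is_solution f x -> `|x 0| < delta ->
      forall t : R, 0 <= t -> `|x t| < eps.

(* fast finite-time stability: Lyapunov stable, and there are a neighbourhood
   (ball of radius r), a continuous positive definite V and constants
   l1, l2 > 0, 0 < a < 1 such that along every solution starting in the
   neighbourhood the upper right Dini derivative of V satisfies
   D^+ V <= - l1 V - l2 V^a, and every such solution reaches the origin at a
   settling time T bounded by 1/(l1 (1-a)) ln ((l1 V(x0)^(1-a) + l2)/l2)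
   and stays there afterwards. *)
Definition FFTS (R : realType) (X : normedModType R) (f : X -> X) : Prop :=
  f 0 = 0 /\ lyap_stable f /\
  exists r : R, 0 < r /\
  exists V : X -> R, continuous V /\ pos_def V /\
  exists l1 l2 a : R, 0 < l1 /\ 0 < l2 /\ 0 < a < 1 /\
  forall x : R -> X, is_solution f x -> `|x 0| < r ->
    (forall t : R, 0 <= t -> forall eps : R, 0 < eps ->
       exists2 h0 : R, 0 < h0 & forall h : R, 0 < h < h0 ->
         (V (x (t + h)) - V (x t)) / h <=
           - l1 * V (x t) - l2 * powR (V (x t)) a + eps) /\
    (exists T : R, 0 <= T /\
       T <= (l1 * (1 - a))^-1 *
              ln ((l1 * powR (V (x 0)) (1 - a) + l2) / l2) /\
       forall t : R, T <= t -> x t = 0).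

Definition expo (R : realType) (p : R) : R := (1 - p) / (3 * p - 2).

Definition phi1 (R : realType) (n : nat) (p k3 : R) (e : 'rV[R]_n) : 'rV[R]_n :=
  if e == 0 then 0 else k3 *: e + powR (dotv e e) (expo p) *: e.

Definition phi2 (R : realType) (n : nat) (p k3 : R) (e : 'rV[R]_n) : 'rV[R]_n :=
  if e == 0 then 0 else
    k3 ^+ 2 *: e
    + (2 * k3 * (2 * p - 1) / (3 * p - 2)) *: (powR (dotv e e) (expo p) *: e)
    + (p / (3 * p - 2)) *: (powR (dotv e e) (2 * (1 - p) / (3 * p - 2)) *: e).

Definition sysf (R : realType) (n : nat) (p k1 k2 k3 : R)
    (z : 'rV[R]_n * 'rV[R]_n) : 'rV[R]_n * 'rV[R]_n :=
  (- k1 *: phi1 p k3 z.1 + z.2, - k2 *: phi2 p k3 z.1).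
Arguments sysf {R} n p k1 k2 k3 z.

(* Main.v *)
(* Write [phi2 = D phi1], where [D] is the (symmetric, positive) Jacobian of
   [phi1].  Then [zeta = (phi1 e1, e2)] satisfies [zeta' = (Astar (x) D) zeta]
   wherever [e1 <> 0], and the quadratic form
   [V = |phi1 e1 - c e2|^2 + d |e2|^2] has
   [V' = - k1 <phi1, D phi1> - (k1 / k2) <e2, D e2>].  The least eigenvalue of
   [D] is [k3 + (1 + 2 q) |e1|^(2 q)] with [q = (1 - p) / (3 p - 2) < 0]; its two
   summands yield the terms [- l1 V] and [- l2 V^a], [a = 1 + q / (1 + 2 q)].
   [V] is not differentiable where [e1 = 0], but if [e1 = 0] and [e2 <> 0] at
   some time, then [e1 <> 0] just after it.  Hence the differential inequality
   holds on a right neighbourhood of every time at which the state is nonzero,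
   and by continuity of [V] this suffices for the Dini inequality, for the
   monotonicity of [V] and for the bound on the settling time. *)

Require Import Defs.
From HB Require Import structures.
From mathcomp Require Import all_boot all_order all_algebra.
From mathcomp Require Import all_classical all_reals all_analysis.
From mathcomp Require Import complex ring lra.
Import Order.TTheory GRing.Theory Num.Theory.
Import numFieldNormedType.Exports.
Local Open Scope ring_scope.
Local Open Scope classical_set_scope.
Set Implicit Arguments.
Unset Strict Implicit.
Unset Printing Implicit Defensive.

Lemma continuous_powR {R : realType} (r y : R) : 0 < y ->
  {for y, continuous (fun w : R => w `^ r)}.
Proof.
move=> y0; apply: differentiable_continuous; apply/derivable1_diffP.
by apply: derivable_powR; rewrite in_itv/= y0.
Qed.

(** * Decay of a scalar function under a right-sided differential inequality *)

Section ScalarInequality.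
Context {R : realType}.
Implicit Types (f W : R -> R) (t : R).

Lemma near_rightP t (P : R -> Prop) :
  (\forall u \near t^'+, P u) <->
  exists2 h0, 0 < h0 & forall h, 0 < h < h0 -> P (t + h).
Proof.
split.
  move=> /nbhs_right0P[e /= e0 He]; exists e => // h /andP[h0 he].
  by apply: He => //=; rewrite sub0r normrN gtr0_norm.
case=> e e0 He; apply/nbhs_right0P; exists e => //= h /=.
by rewrite distrC subr0 => + h0; rewrite gtr0_norm// => he; apply: He; rewrite h0.
Qed.

(** Mean value argument on [[t, t + h]]. The derivative is only required to the right of [t], and
    the right limit supplies continuity at that endpoint, so [f] may fail to be differentiable at
    [t] itself. *)
Lemma right_nonincreasing_near f t :
  f u @[u --> t^'+] --> f t ->
  (\forall u \near t^'+, derivable f u 1 /\ 'D_1 f u <= 0) ->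
  \forall u \near t^'+, f u <= f t.
Proof.
move=> ft /near_rightP[h0 h0_gt0 Hd]; apply/near_rightP; exists h0 => // h hh0.
have Hd' (u : R) : t < u -> u <= t + h -> derivable f u 1 /\ 'D_1 f u <= 0.
  move=> tu uh; have -> : u = t + (u - t) by ring.
  by apply: Hd; lra.
apply: (@ler0_derive1_le_cc _ f t (t + h)); rewrite ?in_itv/= ?lexx; try lra.
- by move=> u; rewrite in_itv/= => /andP[a b]; apply: (Hd' u _ _).1; lra.
- by move=> u; rewrite in_itv/= derive1E => /andP[a b]; apply: (Hd' u _ _).2; lra.
apply/continuous_within_itvP; first lra.
have cf u : t < u -> u <= t + h -> {for u, continuous f}.
  move=> a b; apply: differentiable_continuous; apply/derivable1_diffP.
  by apply: (Hd' u _ _).1.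
split => //.
- by move=> u; rewrite in_itv/= => /andP[a b]; apply: cf; lra.
- by apply: cvg_at_left_filter; apply: cf; lra.
Qed.

(* The supremum [c] of the times up to [b] where [f <= f a] satisfies
   [f c <= f a] by left continuity; if [c < b] the local hypothesis at [c]
   pushes it further. *)
Lemma right_local_nonincreasing f a b : a <= b ->
  (forall t, a < t -> t <= b -> f u @[u --> t^'-] --> f t) ->
  (forall t, a <= t -> t < b -> \forall u \near t^'+, f u <= f t) ->
  f b <= f a.
Proof.
move=> ab fl fr.
pose S := [set t | (a <= t <= b) /\ f t <= f a].
have Sa : S a by split; rewrite ?lexx ?ab.
have Sub : has_ubound S by exists b => t [/andP[]].
have Ssup : has_sup S by split; first by exists a.
pose c := sup S.
have ac : a <= c by apply: ub_le_sup.
have cb : c <= b by apply: ge_sup; [exists a | move=> t [/andP[]]].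
have fc : f c <= f a.
  have [->//|ca] := eqVneq c a.
  rewrite leNgt; apply/negP => fac.
  have {}ca : a < c by rewrite lt_neqAle eq_sym ca.
  have /cvgr_gt/(_ (f a) fac) := fl _ ca cb.
  move=> [e /= e0 He].
  have [t St tc] := sup_adherent e0 Ssup.
  have tc' : t <= c by apply: ub_le_sup.
  have [/andP[at_ tb] ft] := St.
  have [tc2|tc2] := eqVneq t c; first by rewrite tc2 in ft; lra.
  have: f a < f t.
    apply: He => /=; last by rewrite lt_neqAle tc2.
    by rewrite ger0_norm ?subr_ge0//; rewrite -/c in tc; lra.
  by move=> ?; lra.
have [cb'|cb'] := eqVneq c b; first by rewrite -cb'.
have {}cb' : c < b by rewrite lt_neqAle cb'.
have /near_rightP[h0 h00 Hh] := fr _ ac cb'.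
pose h := Num.min (h0 / 2) (b - c).
have h_gt0 : 0 < h by rewrite /h lt_min; apply/andP; split; lra.
have hh0 : h < h0 by rewrite /h gt_min; apply/orP; left; lra.
have hb : h <= b - c by rewrite /h ge_min lexx orbT.
have: S (c + h).
  split; first lra.
  by apply: le_trans fc; apply: Hh; rewrite h_gt0.
by move=> /(ub_le_sup Sub); rewrite -/c => ?; lra.
Qed.

Variables (l1 l2 a : R).
Hypotheses (l1_gt0 : 0 < l1) (l2_gt0 : 0 < l2) (a01 : 0 < a < 1).

Let rate (w : R) := - l1 * w - l2 * w `^ a.

Variable W : R -> R.
Hypothesis W_ge0 : forall t : R, 0 <= t -> 0 <= W t.
Hypothesis W_right : forall t, 0 <= t -> W u @[u --> t^'+] --> W t.
Hypothesis W_left : forall t, 0 < t -> W u @[u --> t^'-] --> W t.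
Hypothesis W_rate : forall t, 0 <= t -> 0 < W t ->
  \forall u \near t^'+, derivable W u 1 /\ 'D_1 W u <= rate (W u).

Let rate_le0 (w : R) : 0 <= w -> rate w <= 0.
Proof.
move=> w0; rewrite /rate; have := powR_ge0 w a.
by move=> ?; rewrite mulNr -opprD oppr_le0 addr_ge0// mulr_ge0// ltW.
Qed.

(** [W_rate] speaks only of times with [W > 0], hence the positivity assumption; absorption at zero
    removes it afterwards. *)
Lemma fast_decay_nonincreasing_pos s t : 0 <= s -> s <= t ->
  (forall u, s <= u -> u < t -> 0 < W u) -> W t <= W s.
Proof.
move=> s0 st Wp; apply: right_local_nonincreasing => //.
  by move=> u su ut; apply: W_left; lra.
move=> u su ut; have u0 : 0 <= u by lra.
apply: right_nonincreasing_near; first exact: W_right.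
have := W_rate u0 (Wp _ su ut); apply: filterS2 (nbhs_right_gt u).
move=> v uv [dv Wv]; split=> //; apply: (le_trans Wv).
by apply: rate_le0; apply: W_ge0; lra.
Qed.

(** If [W t > 0], then [W] is positive on []c, t]] after its last zero [c]. It is nonincreasing
    there, so [W (c + h) >= W t] for all small [h > 0], against right continuity at [c]. *)
Lemma fast_decay_absorbing s t : 0 <= s -> s <= t -> W s = 0 -> W t = 0.
Proof.
move=> s0 st Ws; apply/eqP; rewrite eq_le W_ge0 ?(le_trans s0)// andbT leNgt.
apply/negP => Wt.
(* [c] is the last zero of [W] before [t] *)
pose S := [set u | (s <= u <= t) /\ W u = 0].
have Ss : S s by split; rewrite ?lexx ?st.
have Sub : has_ubound S by exists t => u [/andP[]].
have Ssup : has_sup S by split; first by exists s.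
pose c := sup S.
have sc : s <= c by apply: ub_le_sup.
have ct : c <= t by apply: ge_sup; [exists s | move=> u [/andP[]]].
have Wc : W c = 0.
  have [->//|cs] := eqVneq c s.
  have {}cs : s < c by rewrite lt_neqAle eq_sym cs.
  apply/eqP; rewrite eq_le W_ge0 ?(le_trans s0)// andbT leNgt.
  apply/negP => Wc.
  have c0 : 0 < c by lra.
  have /cvgr_gt/(_ 0 Wc) := W_left c0.
  move=> [e /= e0 He].
  have [u Su uc] := sup_adherent e0 Ssup.
  have uc' : u <= c by apply: ub_le_sup.
  have [/andP[su ut] Wu] := Su.
  have [uc2|uc2] := eqVneq u c; first by rewrite uc2 in Wu; lra.
  have: 0 < W u.
    apply: He => /=; last by rewrite lt_neqAle uc2.
    by rewrite ger0_norm ?subr_ge0//; rewrite -/c in uc; lra.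
  by move=> ?; lra.
have ct' : c < t.
  by rewrite lt_neqAle ct andbT; apply/eqP => cE; rewrite cE in Wc; lra.
have Wpos u : c < u -> u <= t -> 0 < W u.
  move=> cu ut; rewrite lt_neqAle eq_sym W_ge0 ?andbT; last by lra.
  apply/eqP => Wu; have : S u by split=> //; lra.
  by by move=> /(ub_le_sup Sub); rewrite -/c => ?; lra.
have c0 : 0 <= c by lra.
have := W_right c0; rewrite Wc => /cvgr_lt/(_ (W t) Wt)/near_rightP[h0 h00 Hh].
pose h := Num.min (h0 / 2) (t - c).
have h_gt0 : 0 < h by rewrite /h lt_min; apply/andP; split; lra.
have hh0 : h < h0 by rewrite /h gt_min; apply/orP; left; lra.
have hb : h <= t - c by rewrite /h ge_min lexx orbT.
have := Hh h; rewrite h_gt0 hh0 => /(_ isT).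
suff : W t <= W (c + h) by move=> ? ?; lra.
by apply: fast_decay_nonincreasing_pos => [||u u1 u2]; last apply: Wpos; lra.
Qed.

Lemma fast_decay_nonincreasing s t : 0 <= s -> s <= t -> W t <= W s.
Proof.
move=> s0 st.
have t0 : 0 <= t by lra.
have [Wt|Wt] := eqVneq (W t) 0; first by rewrite Wt W_ge0.
apply: fast_decay_nonincreasing_pos => // u su ut.
rewrite lt_neqAle eq_sym W_ge0 ?andbT; last by lra.
by apply: contra_neq Wt; apply: fast_decay_absorbing; lra.
Qed.

Lemma continuous_rate w : 0 < w -> {for w, continuous rate}.
Proof.
move=> w0; rewrite /rate.
apply: (@continuousB _ _ _ (fun w => - l1 * w) (fun w => l2 * w `^ a)).
  by apply: continuousM; [exact: cvg_cst | exact: cvg_id].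
apply: (@continuousM _ _ (cst l2) (fun w => w `^ a)); first exact: cvg_cst.
exact: continuous_powR.
Qed.

(** For [W t > 0], subtract from [W] the line of slope [rate (W t) + eps]: by continuity of [rate]
    the difference has nonpositive derivative just after [t]. For [W t = 0], absorption keeps [W] at
    0. *)
Lemma fast_decay_dini t eps : 0 <= t -> 0 < eps ->
  exists2 h0, 0 < h0 & forall h, 0 < h < h0 ->
    (W (t + h) - W t) / h <= rate (W t) + eps.
Proof.
move=> t0 eps0.
have [Wt|Wt] := eqVneq (W t) 0.
  exists 1 => // h /andP[h0 h1].
  rewrite (@fast_decay_absorbing t (t + h)) ?Wt//; last lra.
  (* Since [powR 0 0 = 1], it takes [a != 0] to make [rate 0] vanish. *)
  have a_neq0 : a != 0 by rewrite gt_eqF//; case/andP: a01.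
  by rewrite subr0 mul0r /rate powR0// !mulr0 subr0 add0r ltW.
have {}Wt : 0 < W t by rewrite lt_neqAle eq_sym Wt W_ge0.
pose g u := W u - (rate (W t) + eps) * u.
have dg (u : R) : derivable W u 1 -> is_derive u 1 g ('D_1 W u - (rate (W t) + eps)).
  move=> dW; have dW' : is_derive u 1 W ('D_1 W u) by exact: derivableP.
  have : is_derive u 1 (fun u => (rate (W t) + eps) *: u) ((rate (W t) + eps) *: 1).
    exact: is_deriveZ.
  by rewrite /GRing.scale/= mulr1 => H; exact: is_deriveB.
have : \forall u \near t^'+, g u <= g t.
  apply: right_nonincreasing_near.
    apply: cvgB; first exact: W_right.
    by apply: cvgM; [exact: cvg_cst | apply: cvg_at_right_filter; exact: cvg_id].
  have cr : rate (W u) @[u --> t^'+] --> rate (W t).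
    by apply: (@cvg_comp _ _ _ W rate _ _ _ (W_right t0)); apply: continuous_rate.
  have lt : rate (W t) < rate (W t) + eps by lra.
  have ev : \forall u \near t^'+, rate (W u) < rate (W t) + eps.
    exact: (cvgr_lt _ cr).
  move: ev; apply: filterS2 (W_rate t0 Wt) => u [du Wu] ru.
  have := dg _ du; split=> //; rewrite derive_val; lra.
move=> /near_rightP[h0 h00 Hh]; exists h0 => // h hh; have := Hh h hh.
rewrite /g; case/andP: hh => h_gt0 _ Hg.
by rewrite ler_pdivrMr//; lra.
Qed.

(** An antiderivative of [1 / (l1 w + l2 w^a)]: its increase from 0 to [w] is the time that
    [w' = rate w] takes to bring [w] down to 0. *)
Let time_to_zero (w : R) := (l1 * (1 - a))^-1 * ln (l1 * w `^ (1 - a) + l2).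

Lemma is_derive_time_to_zero (w : R) : 0 < w ->
  is_derive w 1 time_to_zero (l1 * w + l2 * w `^ a)^-1.
Proof.
move=> w0.
have p0 := powR_gt0 (1 - a) w0.
have pos : 0 < l1 * w `^ (1 - a) + l2 by rewrite addr_gt0// mulr_gt0.
pose g v := l1 * v `^ (1 - a) + l2.
have dg : is_derive w 1 g (l1 *: ((1 - a) * w `^ (1 - a - 1)) + 0).
  apply: (@is_deriveD _ _ _ (fun v => l1 *: (v `^ (1 - a))) (cst l2)).
  apply: is_deriveZ; exact: is_derive1_powR.
have dl : is_derive (g w) 1 (@ln R) (g w)^-1 by apply: is_derive1_ln.
have dc := @is_derive1_comp _ (@ln R) g w _ _ dl dg.
have := @is_deriveZ _ _ _ (@ln R \o g) (l1 * (1 - a))^-1 w 1 _ dc.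
rewrite /GRing.scale/= addr0.
have -> : (l1 * (1 - a))^-1 * ((g w)^-1 * (l1 * ((1 - a) * w `^ (1 - a - 1))))
    = (l1 * w + l2 * w `^ a)^-1.
  have pa := powR_gt0 a w0.
  have E1 : w = w `^ (1 - a) * w `^ a.
    by rewrite -powRD ?subrK ?powRr1 ?ltW// (gt_eqF w0) implybT.
  have E2 : w `^ (1 - a - 1) * w `^ a = 1.
    by rewrite -powRD ?(gt_eqF w0) ?implybT// (_ : 1 - a - 1 + a = 0) ?powRr0//; ring.
  (* Factoring out [w^a] exhibits the argument of the logarithm. *)
  have -> : l1 * w + l2 * w `^ a = g w * w `^ a by rewrite {1}E1 /g; ring.
  have -> : w `^ (1 - a - 1) = (w `^ a)^-1.
    by apply: (mulIf (lt0r_neq0 pa)); rewrite E2 mulVf// gt_eqF.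
  have n1 : l1 != 0 by rewrite gt_eqF.
  have n2 : 1 - a != 0 by rewrite subr_eq0 gt_eqF//; case/andP: a01.
  have n3 : w `^ a != 0 by rewrite gt_eqF.
  have n4 : g w != 0 by rewrite gt_eqF.
  by field; rewrite n1 n2 n3 n4.
by [].
Qed.

(** While [W > 0], the function [time_to_zero (W u) + u] is nonincreasing. Were [W T] positive,
    comparing times 0 and [T] would give [time_to_zero (W T) <= time_to_zero 0], against strict
    growth of the logarithm. *)
Lemma fast_decay_settling t :
  (l1 * (1 - a))^-1 * ln ((l1 * W 0 `^ (1 - a) + l2) / l2) <= t -> W t = 0.
Proof.
set T := (X in X <= t) => Tt.
have Wa0 : 0 <= l1 * W 0 `^ (1 - a) by rewrite mulr_ge0// ?powR_ge0// ltW.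
have cpos : 0 < (l1 * (1 - a))^-1 by rewrite invr_gt0 mulr_gt0// subr_gt0; case/andP: a01.
have T0 : 0 <= T.
  apply: mulr_ge0; first exact: ltW.
  by apply: ln_ge0; rewrite ler_pdivlMr// mul1r; lra.
(* Zero is absorbing, so only the time [T] itself matters. *)
apply: (fast_decay_absorbing _ Tt) => //.
apply/eqP; rewrite -[_ == _]negbK; apply/negP => WT.
have Wpos u : 0 <= u -> u <= T -> 0 < W u.
  move=> u0 uT; rewrite lt_neqAle eq_sym W_ge0 ?andbT//.
  by apply: contra_neq WT; apply: fast_decay_absorbing.
pose g u := time_to_zero (W u) + u.
have gW (u : R) : 0 < W u -> derivable W u 1 ->
    is_derive u 1 g ((l1 * W u + l2 * W u `^ a)^-1 * 'D_1 W u + 1).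
  move=> Wu du.
  have dW' : is_derive u 1 W ('D_1 W u) by exact: derivableP.
  have dz := is_derive_time_to_zero Wu.
  have dc := @is_derive1_comp _ time_to_zero W u _ _ dz dW'.
  exact: (@is_deriveD _ _ _ (time_to_zero \o W) id).
have ctz w : 0 < w -> {for w, continuous time_to_zero}.
  move=> w0; apply: differentiable_continuous; apply/derivable1_diffP.
  by have [] := is_derive_time_to_zero w0.
have : g T <= g 0.
  apply: right_local_nonincreasing => //.
    move=> u u0 uT; apply: cvgD; last by apply: cvg_at_left_filter; exact: cvg_id.
    apply: (@cvg_comp _ _ _ W time_to_zero _ _ _ (W_left u0)).
    by apply: ctz; apply: Wpos; lra.
  move=> u u0 uT; have Wu : 0 < W u by apply: Wpos; lra.
  apply: right_nonincreasing_near.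
    apply: cvgD; last by apply: cvg_at_right_filter; exact: cvg_id.
    apply: (@cvg_comp _ _ _ W time_to_zero _ _ _ (W_right u0)).
    exact: ctz.
  have ev : \forall v \near u^'+, 0 < W v by exact: (cvgr_gt _ (W_right u0)).
  move: ev; apply: filterS2 (W_rate u0 Wu) => v [dv Wv] Wv0.
  have := gW _ Wv0 dv; split=> //; rewrite derive_val.
  have den : 0 < l1 * W v + l2 * W v `^ a.
    by rewrite addr_gt0// mulr_gt0// powR_gt0.
  rewrite -lerBrDr sub0r ler_pdivrMl// mulrN1.
  by move: Wv; rewrite /rate => ?; lra.
rewrite /g addr0 /time_to_zero {2}/T.
move: cpos; set k := (l1 * (1 - a))^-1 => cpos.
have WT0 : 0 < W T by apply: Wpos.
have WTa : 0 < l1 * W T `^ (1 - a) by rewrite mulr_gt0// powR_gt0.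
rewrite ln_div ?posrE//; last by rewrite ltr_wpDl.
rewrite mulrBr => H.
have : k * ln l2 < k * ln (l1 * W T `^ (1 - a) + l2).
  by rewrite ltr_pM2l// ltr_ln ?posrE ?ltrDr ?addr_gt0.
by move=> H2; lra.
Qed.

End ScalarInequality.

(** * The Euclidean inner product on row vectors *)

Section DotProduct.
Context {R : realType} {n : nat}.
Implicit Types (x y z : 'rV[R]_n).

Lemma dotvC x y : dotv x y = dotv y x.
Proof. by apply: eq_bigr => i _; rewrite mulrC. Qed.

Lemma dotvDl x y z : dotv (x + y) z = dotv x z + dotv y z.
Proof. by rewrite -big_split; apply: eq_bigr => i _; rewrite !mxE mulrDl. Qed.

Lemma dotvZl (k : R) x y : dotv (k *: x) y = k * dotv x y.
Proof. by rewrite mulr_sumr; apply: eq_bigr => i _; rewrite !mxE mulrA. Qed.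

Lemma dotvDr x y z : dotv z (x + y) = dotv z x + dotv z y.
Proof. by rewrite dotvC dotvDl !(dotvC z). Qed.

Lemma dotvZr (k : R) x y : dotv x (k *: y) = k * dotv x y.
Proof. by rewrite dotvC dotvZl dotvC. Qed.

Lemma dotv0l y : dotv 0 y = 0.
Proof. by apply: big1 => i _; rewrite mxE mul0r. Qed.

Lemma dotv_ge0 x : 0 <= dotv x x.
Proof. by apply: sumr_ge0 => i _; rewrite -expr2 sqr_ge0. Qed.

Lemma coord_sqr_le_dotv x i : x 0 i ^+ 2 <= dotv x x.
Proof.
rewrite /dotv (bigD1 i)//= -expr2 lerDl.
by apply: sumr_ge0 => j _; rewrite -expr2 sqr_ge0.
Qed.

Lemma dotv_eq0 x : (dotv x x == 0) = (x == 0).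
Proof.
apply/eqP/eqP => [x0|->]; last exact: dotv0l.
apply/rowP => i; rewrite mxE; apply/eqP; rewrite -sqrf_eq0 eq_le sqr_ge0 andbT.
by rewrite -x0 coord_sqr_le_dotv.
Qed.

Lemma dotv_gt0 x : (0 < dotv x x) = (x != 0).
Proof. by rewrite lt_neqAle dotv_ge0 andbT eq_sym dotv_eq0. Qed.

(** The squared length of [<y,y> x - <x,y> y] equals [<y,y> (<x,x> <y,y> - <x,y>^2)]; divide by
    [<y,y> > 0]. *)
Lemma dotv_CauchySchwarz x y : dotv x y ^+ 2 <= dotv x x * dotv y y.
Proof.
have [->|y0] := eqVneq y 0; first by rewrite dotvC dotv0l expr0n/= dotv0l mulr0.
have yy : 0 < dotv y y by rewrite dotv_gt0.
have := dotv_ge0 (dotv y y *: x + (- dotv x y) *: y).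
rewrite !(dotvDl, dotvDr, dotvZl, dotvZr) (dotvC y x).
set X := dotv x x; set Y := dotv y y; set Z := dotv x y => H.
have : 0 <= Y * (X * Y - Z ^+ 2).
  by apply: (le_trans H); rewrite le_eqVlt; apply/orP; left; apply/eqP; ring.
by rewrite pmulr_rge0// subr_ge0.
Qed.

(** The norm on row vectors is the sup norm, attained at a coordinate. This links Euclidean
    estimates to the norm used in the definition of stability. *)
Lemma rV_norm_sqr_le_dotv x : `|x| ^+ 2 <= dotv x x.
Proof.
have [->|x0] := eqVneq x 0; first by rewrite normr0 expr0n/= dotv0l.
have : mx_norm x != 0 by move: x0; apply: contraNneq => /mx_norm_eq0 ->.
move=> /mx_norm_neq0[[i j]/=]; rewrite ord1 => E.
by rewrite (_ : `|x| = `|x 0 j|)// real_normK ?num_real// coord_sqr_le_dotv.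
Qed.

Lemma dotv_cvg {T : Type} {F : set_system T} {FF : Filter F}
    (f g : T -> 'rV[R]_n) x y :
  f u @[u --> F] --> x -> g u @[u --> F] --> y ->
  (dotv (f u) (g u) : R) @[u --> F] --> (dotv x y : R).
Proof.
move=> fx gy; rewrite /dotv.
have coord (h : T -> 'rV[R]_n) z i : h u @[u --> F] --> z -> h u 0 i @[u --> F] --> z 0 i.
  move=> hz; apply: (@cvg_comp _ _ _ h (fun w : 'rV[R]_n => w 0 i) _ _ _ hz).
  exact: coord_continuous.
apply: cvg_big => [|i _]; first exact: add_continuous.
by apply: cvgM; apply: coord.
Qed.

Lemma is_derive_dotv (f g : R -> 'rV[R]_n) (t : R) (df dg : 'rV[R]_n) :
  (forall i, is_derive t 1 (fun u => f u 0 i) (df 0 i)) ->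
  (forall i, is_derive t 1 (fun u => g u 0 i) (dg 0 i)) ->
  is_derive t 1 (fun u => dotv (f u) (g u)) (dotv df (g t) + dotv (f t) dg).
Proof.
move=> Hf Hg.
have H i : is_derive t 1 ((fun u => f u 0 i) * (fun u => g u 0 i))
     (f t 0 i *: dg 0 i + g t 0 i *: df 0 i) by exact: is_deriveM.
have := is_derive_sum H.
have -> : \sum_(i < n) ((fun u => f u 0 i) * (fun u => g u 0 i)) =
    (fun u => dotv (f u) (g u)).
  by apply/funext => u; rewrite fct_sumE; apply: eq_bigr.
have -> // : \sum_(i < n) (f t 0 i *: dg 0 i + g t 0 i *: df 0 i) =
    dotv df (g t) + dotv (f t) dg.
rewrite -big_split; apply: eq_bigr => i _.
by rewrite /GRing.scale/= addrC (mulrC (g t 0 i)).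
Qed.

End DotProduct.

(** * Derivatives of coordinates and continuity of solutions *)

Lemma is_derive_linear_comp {R : realType} {X : normedModType R} (L : {linear X -> R^o})
    (x : R -> X) (t : R) (d : X) : continuous L ->
  is_derive t 1 x d -> is_derive t 1 (L \o x : R -> R) (L d).
Proof.
move=> cL [dx xd].
have dx' : (fun h : R => h^-1 *: (x (h *: 1 + t) - x t)) @ 0^' --> d.
  by rewrite -xd; exact: dx.
have H : (fun h : R => h^-1 *: ((L \o x) (h *: 1 + t) - (L \o x) t)) @ 0^' --> L d.
  have := @cvg_comp _ _ _ _ L _ _ _ dx' (cL d).
  by apply: cvg_trans; apply: near_eq_cvg; near=> h; rewrite /= linearZ linearB.
split; first by apply/cvg_ex; exists (L d).
exact: cvg_lim.
Unshelve. all: by end_near.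
Qed.

Section SolutionCoordinates.
Context {R : realType} {n : nat}.
Implicit Types (x : R -> 'rV[R]_n * 'rV[R]_n).

Lemma is_derive_fst_coord x (t : R) d i :
  is_derive t 1 x d -> is_derive t 1 (fun u => (x u).1 0 i) (d.1 0 i).
Proof.
pose L (z : 'rV[R]_n * 'rV[R]_n) : R^o := z.1 0 i.
have lL : linear L by move=> k u v; rewrite /L/= !mxE.
pose Lm := GRing.isLinear.Build _ _ _ _ L lL.
pose L' : {linear _ -> _} := HB.pack L Lm.
apply: (@is_derive_linear_comp _ _ L') => z.
apply: (@cvg_comp _ _ _ fst (fun w : 'rV[R]_n => w 0 i) _ (nbhs z.1)).
  exact: cvg_fst.
exact: coord_continuous.
Qed.

Lemma is_derive_snd_coord x (t : R) d i :
  is_derive t 1 x d -> is_derive t 1 (fun u => (x u).2 0 i) (d.2 0 i).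
Proof.
pose L (z : 'rV[R]_n * 'rV[R]_n) : R^o := z.2 0 i.
have lL : linear L by move=> k u v; rewrite /L/= !mxE.
pose Lm := GRing.isLinear.Build _ _ _ _ L lL.
pose L' : {linear _ -> _} := HB.pack L Lm.
apply: (@is_derive_linear_comp _ _ L') => z.
apply: (@cvg_comp _ _ _ snd (fun w : 'rV[R]_n => w 0 i) _ (nbhs z.2)).
  exact: cvg_snd.
exact: coord_continuous.
Qed.

End SolutionCoordinates.

Section SolutionContinuity.
Context {R : realType} {X : normedModType R}.
Variables (f : X -> X) (x : R -> X).
Hypothesis sol : is_solution f x.

Lemma solution_is_derive (t : R) : 0 < t -> is_derive t 1 x (f (x t)).
Proof. by move=> t0; have [d e] := sol.2 t t0; split. Qed.

Lemma solution_continuous (t : R) : 0 < t -> {for t, continuous x}.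
Proof.
move=> t0; apply: differentiable_continuous; apply/derivable1_diffP.
by have [] := sol.2 t t0.
Qed.

Lemma solution_right (t : R) : 0 <= t -> x u @[u --> t^'+] --> x t.
Proof.
rewrite le_eqVlt => /orP[/eqP <-|t0]; first exact: sol.1.
by apply: cvg_at_right_filter; apply: solution_continuous.
Qed.

Lemma solution_left (t : R) : 0 < t -> x u @[u --> t^'-] --> x t.
Proof. by move=> t0; apply: cvg_at_left_filter; apply: solution_continuous. Qed.

End SolutionContinuity.

(** * Real powers near zero and an arithmetic-geometric mean bound *)

Lemma continuous_powR_norm {R : realType} (r : R) : 0 < r ->
  continuous (fun y : R => `|y| `^ r).
Proof.
move=> r0 y; have [->|y0] := eqVneq y 0.
  (* The radius [e^(1/r)] is chosen so that its [r]-th power is [e]. *)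
  apply/cvgrPdist_lt => e e0; have e' : 0 < e `^ r^-1 by rewrite powR_gt0.
  have ev : \forall z \near (0 : R), `|z| < e `^ r^-1 by exact: nbhs0_lt.
  move: ev; apply: filterS => z ze.
  rewrite normr0 powR0 ?gt_eqF// sub0r normrN ger0_norm ?powR_ge0//.
  rewrite -[ltRHS](_ : (e `^ r^-1) `^ r = e); last first.
    by rewrite -powRrM mulVf ?powRr1 ?gt_eqF// ltW.
  by apply: gt0_ltr_powR; rewrite ?nnegrE ?powR_ge0.
apply: (@continuous_comp _ _ _ (fun y : R => `|y|) (fun w : R => w `^ r)).
  exact: norm_continuous.
by apply: continuous_powR; rewrite normr_gt0.
Qed.

Lemma norm2_le_add {R : realDomainType} (G X Y : R) : 0 <= X -> 0 <= Y ->
  G ^+ 2 <= X * Y -> `|2 * G| <= X + Y.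
Proof.
move=> X0 Y0 GXY; rewrite -ler_sqr ?nnegrE ?addr_ge0// real_normK ?num_real//.
have := sqr_ge0 (X - Y); nra.
Qed.

(** At [s = 0] both sides vanish whatever the value of [s^q]. For [-1/2 < q < 0] this trades a
    singular power for one with positive exponent. *)
Lemma powR_1D2M {R : realType} (s q : R) : 0 <= s -> 1 + 2 * q != 0 ->
  s `^ (1 + 2 * q) = (s `^ q) ^+ 2 * s.
Proof.
move=> s0 q0; have [->|s_neq0] := eqVneq s 0; first by rewrite powR0// mulr0.
rewrite powRD ?s_neq0 ?implybT// powRr1// mulrC mulr2n mulrDl !mul1r.
by rewrite powRD ?s_neq0 ?implybT.
Qed.

(** * The Lyapunov function in terms of three scalar invariants *)

Section LyapunovFunction.
Context {R : realType}.
Variables (k1 k2 k3 q : R).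
Hypotheses (k1_gt0 : 0 < k1) (k2_gt0 : 0 < k2) (k3_gt0 : 0 < k3).
Hypothesis q_lt0 : q < 0.
Hypothesis q_gt : - 4^-1 < q.

(** The matrix [P = [1, -c; -c, c^2 + d]] solves the Lyapunov equation [Astar^T P + P Astar = - diag
    (k1, k1 / k2)]. *)
Definition lyap_c : R := k1 / (2 * k2).
Definition lyap_d : R := k2^-1 + k1 ^+ 2 / (4 * k2 ^+ 2).

(* With [s = |e1|^2], [B = <e1, e2>], [C = |e2|^2], this is
   [|phi1 e1 - c e2|^2 + d |e2|^2]; the constants make the derivative along the
   linear system [Astar] diagonal. *)
Definition lyap_sc (s B C : R) : R :=
  (k3 + s `^ q) ^+ 2 * s - 2 * lyap_c * ((k3 + s `^ q) * B)
  + (lyap_c ^+ 2 + lyap_d) * C.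

(** This is [|phi1 e1|^2 + |e2|^2], to which the quadratic form is equivalent. *)
Definition lyap_energy (s C : R) : R := (k3 + s `^ q) ^+ 2 * s + C.

Definition lyap_upper : R := 2 + 2 * lyap_c ^+ 2 + lyap_d.
Definition lyap_lower : R := lyap_d / 2 / (lyap_c ^+ 2 + lyap_d / 2 + 1).

Lemma lyap_d_gt0 : 0 < lyap_d.
Proof.
by rewrite /lyap_d addr_gt0 ?invr_gt0// divr_gt0 ?mulr_gt0 ?exprn_gt0.
Qed.

Lemma lyap_lower_gt0 : 0 < lyap_lower.
Proof.
have := lyap_d_gt0; have := sqr_ge0 lyap_c => c0 d0.
by rewrite /lyap_lower !divr_gt0//; lra.
Qed.

Lemma lyap_upper_gt0 : 0 < lyap_upper.
Proof. by have := lyap_d_gt0; have := sqr_ge0 lyap_c; rewrite /lyap_upper; lra. Qed.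

Section Bounds.
Variables (s B C : R).
Hypotheses (s_ge0 : 0 <= s) (C_ge0 : 0 <= C) (BsC : B ^+ 2 <= s * C).

Let F := (k3 + s `^ q) ^+ 2 * s.
Let G := (k3 + s `^ q) * B.

Let F_ge0 : 0 <= F.
Proof. by rewrite mulr_ge0// sqr_ge0. Qed.

Let GFC : G ^+ 2 <= F * C.
Proof.
by rewrite /G /F exprMn -mulrA ler_wpM2l// sqr_ge0.
Qed.

(** [B ^+ 2 <= s * C] stands for Cauchy-Schwarz on [e1], [e2] and passes to [G], [F], [C]. The cross
    term [2 c G] costs at most [F + c^2 C], leaving [2 F + (2 c^2 + d) C]. *)
Lemma lyap_sc_upper : lyap_sc s B C <= lyap_upper * lyap_energy s C.
Proof.
have c0 := sqr_ge0 lyap_c; have d0 := lyap_d_gt0.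
have : `|2 * (lyap_c * G)| <= F + lyap_c ^+ 2 * C.
  apply: norm2_le_add => //; first exact: mulr_ge0.
  by rewrite exprMn [leRHS]mulrCA ler_wpM2l.
rewrite ler_norml => /andP[H _].
have -> : lyap_sc s B C = F - 2 * (lyap_c * G) + (lyap_c ^+ 2 + lyap_d) * C.
  by rewrite /lyap_sc /F /G; ring.
rewrite /lyap_energy -/F /lyap_upper.
have := mulr_ge0 c0 F_ge0; have := mulr_ge0 (ltW d0) F_ge0.
move: F_ge0 C_ge0 => f0 g0; move: H; set x := lyap_c ^+ 2.
set y := lyap_c * G; move=> H h1 h2; lra.
Qed.

(** Weighting the cross term by [e = c^2 + d / 2] leaves [(d / 2) / e * F + (d / 2) * C]; the extra
    1 in the denominator of [lyap_lower] puts it below both coefficients. *)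
Lemma lyap_sc_lower : lyap_lower * lyap_energy s C <= lyap_sc s B C.
Proof.
have d0 := lyap_d_gt0; have c20 := sqr_ge0 lyap_c.
pose e := lyap_c ^+ 2 + lyap_d / 2.
have e0 : 0 < e by rewrite /e; lra.
have : `|2 * (lyap_c * G)| <= lyap_c ^+ 2 / e * F + e * C.
  apply: norm2_le_add.
  - by apply: mulr_ge0 => //; rewrite divr_ge0 ?(ltW e0).
  - by rewrite mulr_ge0 ?(ltW e0).
  have -> : lyap_c ^+ 2 / e * F * (e * C) = lyap_c ^+ 2 * (F * C).
    by field; rewrite gt_eqF.
  by rewrite exprMn ler_wpM2l.
rewrite ler_norml => /andP[_ H].
have -> : lyap_sc s B C = F - 2 * (lyap_c * G) + (lyap_c ^+ 2 + lyap_d) * C.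
  by rewrite /lyap_sc /F /G; ring.
have E1 : lyap_c ^+ 2 / e = 1 - lyap_d / 2 / e.
  by rewrite /e; field; rewrite -/e; apply/eqP => e1; lra.
rewrite E1 in H.
have L1 : lyap_lower <= lyap_d / 2 / e.
  by rewrite /lyap_lower -/e ler_pM2l ?lef_pV2 ?posrE; lra.
have L2 : lyap_lower <= lyap_d / 2.
  by rewrite /lyap_lower ler_pdivrMr; nra.
have H1 := ler_wpM2r F_ge0 L1; have H2 := ler_wpM2r C_ge0 L2.
rewrite /lyap_energy -/F mulrDr.
by move: H; rewrite /e; move: (lyap_d / 2 / _) H1 => w H1 H; lra.
Qed.

Lemma sqr_le_lyap_energy : k3 ^+ 2 * s <= lyap_energy s C.
Proof.
rewrite /lyap_energy; apply: ler_wpDr => //; apply: ler_wpM2r => //.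
by have := powR_ge0 s q; have := k3_gt0; nra.
Qed.

End Bounds.

(** For [q = expo p] this exponent is [1 / p]. *)
Definition lyap_exp : R := 1 + q / (1 + 2 * q).
Definition lyap_m : R := Num.min k1 (k1 / k2).
Definition lyap_l1 : R := lyap_m * k3 / lyap_upper.
Definition lyap_l2 : R := lyap_m * (1 + 2 * q) / lyap_upper `^ lyap_exp.

Let q2_gt0 : 0 < 1 + 2 * q. Proof. by move: q_gt; lra. Qed.

Lemma lyap_exp01 : 0 < lyap_exp < 1.
Proof.
have -> : lyap_exp = (1 + 3 * q) / (1 + 2 * q).
  by rewrite /lyap_exp; field; rewrite gt_eqF.
by rewrite ltr_pdivrMr// divr_gt0//=; move: q_gt q_lt0 => ? ?; lra.
Qed.

Lemma lyap_m_gt0 : 0 < lyap_m.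
Proof. by rewrite /lyap_m lt_min k1_gt0 divr_gt0. Qed.

Lemma lyap_l1_gt0 : 0 < lyap_l1.
Proof. by rewrite /lyap_l1 divr_gt0 ?mulr_gt0 ?lyap_m_gt0 ?lyap_upper_gt0. Qed.

Lemma lyap_l2_gt0 : 0 < lyap_l2.
Proof.
by rewrite /lyap_l2 divr_gt0 ?mulr_gt0 ?lyap_m_gt0 ?powR_gt0 ?lyap_upper_gt0.
Qed.

(** The Jacobian is [D = (k3 + sg) I + 2 q (sg / s) e1 e1^T]. The first term uses its eigenvalue
    [k3 + (1 + 2 q) sg] along [e1], the second is [<e2, D e2>] expanded. *)
Definition lyap_dot (s B C : R) : R :=
  let sg := s `^ q in
  - k1 * ((k3 + sg) ^+ 2 * s * (k3 + (1 + 2 * q) * sg))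
  - k1 / k2 * ((k3 + sg) * C + 2 * q * sg * (B ^+ 2 / s)).

Lemma is_derive_lyap_sc (s B C : R -> R) (t : R) : 0 < s t ->
  let sg := s t `^ q in
  let rho := k3 ^+ 2 + (2 + 2 * q) * k3 * sg + (1 + 2 * q) * sg ^+ 2 in
  is_derive t 1 s (2 * (- k1 * (k3 + sg) * s t + B t)) ->
  is_derive t 1 B (- k1 * (k3 + sg) * B t + C t - k2 * rho * s t) ->
  is_derive t 1 C (- 2 * k2 * rho * B t) ->
  is_derive t 1 (fun u => lyap_sc (s u) (B u) (C u)) (lyap_dot (s t) (B t) (C t)).
Proof.
move=> st sg rho.
set ds := 2 * _; set dB := _ - _; set dC := _ * B t => Hs HB HC.
have sgE : s t `^ (q - 1) = sg / s t.
  by rewrite powRB ?powRr1 ?ltW// (gt_eqF st) implybT.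
have Hsg : is_derive t 1 (fun u => s u `^ q) (q * (sg / s t) * ds).
  rewrite -sgE; apply: (@is_derive1_comp _ (fun w => w `^ q) s).
  exact: is_derive1_powR.
pose f1 : R -> R := fun u => k3 + s u `^ q.
have H1 : is_derive t 1 f1 (q * (sg / s t) * ds).
  rewrite -[X in is_derive _ _ _ X]add0r.
  exact: (@is_deriveD _ _ _ (cst k3) (fun u => s u `^ q)).
have -> : (fun u => lyap_sc (s u) (B u) (C u)) =
   (f1 * f1 * s - (2 * lyap_c) *: (f1 * B) + (lyap_c ^+ 2 + lyap_d) *: C).
  by apply/funext => u.
have H2 := is_deriveD (is_deriveB (is_deriveM (is_deriveM H1 H1) Hs)
  (is_deriveZ (2 * lyap_c) (is_deriveM H1 HB)))
  (is_deriveZ (lyap_c ^+ 2 + lyap_d) HC).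
apply: (is_derive_eq H2).
have -> : (f1 * f1) t = (k3 + sg) * (k3 + sg) by [].
rewrite /GRing.scale/= -/sg /f1 /lyap_dot -/sg /ds /dB /dC /rho /lyap_c /lyap_d.
(* Here [rho = (k3 + sg) (k3 + (1 + 2 q) sg)], and the choice of [c] and [d] cancels the cross
   terms. *)
by field; rewrite !gt_eqF.
Qed.

(** The energy [N] dominates [s^(1 + 2 q)], so with [b = - q / (1 + 2 q) = 1 - lyap_exp] one has
    [N^b >= s^(- q)]; multiply by [s^q N^lyap_exp]. *)
Lemma lyap_energy_powR (s C : R) : 0 < s -> 0 <= C ->
  lyap_energy s C `^ lyap_exp <= s `^ q * lyap_energy s C.
Proof.
move=> s0 C0; set N := lyap_energy s C.
have sg0 := powR_gt0 q s0.
have sN : s `^ (1 + 2 * q) <= N.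
  rewrite powR_1D2M ?(ltW s0) ?gt_eqF//.
  rewrite /N /lyap_energy; apply: ler_wpDr => //; apply: ler_wpM2r; first exact: ltW.
  by move: sg0 k3_gt0 => ? ?; nra.
have N0 : 0 < N by apply: lt_le_trans sN; rewrite powR_gt0.
pose b := - q / (1 + 2 * q).
have b0 : 0 <= b by rewrite /b divr_ge0 ?oppr_ge0 ?ltW.
have Eb : (1 + 2 * q) * b = - q by rewrite /b; field; rewrite gt_eqF.
have H : s `^ (- q) <= N `^ b.
  rewrite -Eb powRrM; apply: ge0_ler_powR => //; rewrite nnegrE ?powR_ge0//.
  exact: ltW.
have EN : N = N `^ lyap_exp * N `^ b.
  rewrite -powRD ?(gt_eqF N0) ?implybT//.
  by rewrite (_ : lyap_exp + b = 1) ?powRr1 ?ltW// /lyap_exp /b; field; rewrite gt_eqF.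
rewrite [in leRHS]EN mulrCA -[leLHS]mulr1 ler_wpM2l ?powR_ge0//.
have -> : 1 = s `^ q * s `^ (- q) by rewrite -powRD ?(gt_eqF s0) ?implybT// subrr powRr0.
by rewrite ler_wpM2l// ltW.
Qed.

Lemma lyap_dot_le (s B C : R) : 0 < s -> 0 <= C -> B ^+ 2 <= s * C ->
  lyap_dot s B C <= - lyap_l1 * lyap_sc s B C - lyap_l2 * lyap_sc s B C `^ lyap_exp.
Proof.
move=> s0 C0 BsC; have s0' := ltW s0.
set N := lyap_energy s C; set V := lyap_sc s B C; set M := lyap_upper.
have M0 : 0 < M := lyap_upper_gt0.
have m0 : 0 < lyap_m := lyap_m_gt0.
have sg0 := powR_gt0 q s0; set sg := s `^ q in sg0.
have /andP[a0 a1] := lyap_exp01.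
have N0 : 0 <= N by rewrite /N /lyap_energy addr_ge0// mulr_ge0// sqr_ge0.
have VMN : V <= M * N by apply: lyap_sc_upper.
have V0 : 0 <= V.
  apply: (le_trans _ (lyap_sc_lower s0' C0 BsC)).
  by rewrite mulr_ge0// ltW// lyap_lower_gt0.
(* Both quadratic forms are bounded below by the least eigenvalue of [D]; as [q < 0], the upper
   bound [B^2 / s <= C] bounds [<e2, D e2>] from below. *)
have S1 : lyap_dot s B C <= - (lyap_m * (k3 + (1 + 2 * q) * sg) * N).
  set w := k3 + (1 + 2 * q) * sg.
  have w0 : 0 <= w by rewrite /w addr_ge0 ?mulr_ge0 ?ltW.
  have P1 : w * C <= (k3 + sg) * C + 2 * q * sg * (B ^+ 2 / s).
    have : B ^+ 2 / s <= C by rewrite ler_pdivrMr// mulrC.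
    rewrite /w; have qs : 2 * q * sg <= 0 by rewrite nmulr_rle0 ?ltW//; move: q_lt0; lra.
    by move: (B ^+ 2 / s) => y yC; have := ler_wnM2l qs yC; lra.
  have m1 : lyap_m <= k1 by rewrite /lyap_m ge_min lexx.
  have m2 : lyap_m <= k1 / k2 by rewrite /lyap_m ge_min lexx orbT.
  rewrite /lyap_dot -/sg -/w.
  have F0 : 0 <= (k3 + sg) ^+ 2 * s by rewrite mulr_ge0 ?sqr_ge0.
  have Q1 := ler_wpM2r (mulr_ge0 F0 w0) m1.
  have Q2 := ler_wpM2r (mulr_ge0 w0 C0) m2.
  have k12 : 0 <= k1 / k2 by rewrite divr_ge0 ?ltW.
  have Q3 := ler_wpM2l k12 P1.
  rewrite /N /lyap_energy -/sg.
  move: ((k3 + sg) * C + _) Q3 => y Q3; move: ((k3 + sg) ^+ 2 * s) Q1 => F Q1; lra.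
apply: (le_trans S1).
(* The two summands of the eigenvalue are treated separately, each passing from [N] to [V] through
   [V <= M * N]. *)
have P1 : lyap_l1 * V <= lyap_m * k3 * N.
  rewrite /lyap_l1 -/M.
  have -> : lyap_m * k3 * N = lyap_m * k3 / M * (M * N) by field; rewrite gt_eqF.
  by rewrite ler_wpM2l// divr_ge0 ?mulr_ge0 ?ltW.
have P2 : lyap_l2 * V `^ lyap_exp <= lyap_m * (1 + 2 * q) * (sg * N).
  rewrite /lyap_l2 -/M -[leLHS]mulrA; apply: ler_wpM2l.
    by rewrite mulr_ge0 ?ltW.
  rewrite ler_pdivrMl ?powR_gt0//.
  apply: (@le_trans _ _ ((M * N) `^ lyap_exp)).
    by apply: ge0_ler_powR; rewrite ?nnegrE ?mulr_ge0// ltW.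
  rewrite powRM ?(ltW M0)// ler_wpM2l ?powR_ge0//.
  exact: lyap_energy_powR.
by move: P1 P2; move: (V `^ _) => y P1 P2; lra.
Qed.

End LyapunovFunction.

(** * The Lyapunov function along solutions of the system *)

Section ErrorSystem.
Context {R : realType}.
Variables (n : nat) (p k1 k2 k3 : R).
Hypotheses (p12 : 1 < p < 2).
Hypotheses (k3_gt0 : 0 < k3) (k1_gt0 : 0 < k1) (k2_gt0 : 0 < k2).

Let X := ('rV[R]_n * 'rV[R]_n)%type.
Let q := expo p.
Let f := sysf n p k1 k2 k3.

Let p_den_gt0 : 0 < 3 * p - 2. Proof. by case/andP: p12 => ? ?; lra. Qed.

Let q_lt0 : q < 0.
Proof.
by rewrite /q /expo pmulr_llt0 ?invr_gt0//; case/andP: p12 => ? ?; lra.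
Qed.

Let q_gt : - 4^-1 < q.
Proof.
by rewrite /q /expo ltr_pdivlMr//; case/andP: p12 => ? ?; lra.
Qed.

Lemma phi1E (e : 'rV[R]_n) : phi1 p k3 e = (k3 + dotv e e `^ q) *: e.
Proof.
rewrite /phi1; case: eqP => [->|_]; first by rewrite scaler0.
by rewrite scalerDl.
Qed.

(** In terms of [q], the coefficients are [(2 p - 1) / (3 p - 2) = 1 + q] and
    [p / (3 p - 2) = 1 + 2 q]. The case [e = 0] merges because the vector factor vanishes. *)
Lemma phi2E (e : 'rV[R]_n) : phi2 p k3 e =
  (k3 ^+ 2 + (2 + 2 * q) * k3 * dotv e e `^ q
   + (1 + 2 * q) * (dotv e e `^ q) ^+ 2) *: e.
Proof.
rewrite /phi2; case: eqP => [->|/eqP e0]; first by rewrite scaler0.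
have s0 : dotv e e != 0 by rewrite dotv_eq0.
have -> : 2 * (1 - p) / (3 * p - 2) = q + q.
  by rewrite /q /expo; field; rewrite gt_eqF.
rewrite powRD ?s0 ?implybT// !scalerA -!scalerDl.
congr (_ *: _); rewrite -/q; move: (_ `^ q) => sg.
by rewrite /q /expo; field; rewrite gt_eqF.
Qed.

Definition lyap (z : X) : R :=
  lyap_sc k1 k2 k3 q (dotv z.1 z.1) (dotv z.1 z.2) (dotv z.2 z.2).

(** At [e = 0] the power is singular, but by Cauchy-Schwarz the square of the product is at most
    [s^(1 + 2 q) |h|^2], which tends to 0 because [1 + 2 q > 0]. *)
Lemma cvg_powR_dotv_mul {T : Type} {F : set_system T} {FF : Filter F}
    (g h : T -> 'rV[R]_n) (e b : 'rV[R]_n) :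
  g u @[u --> F] --> e -> h u @[u --> F] --> b ->
  (dotv (g u) (g u) `^ q * dotv (g u) (h u) : R) @[u --> F] -->
  (dotv e e `^ q * dotv e b : R).
Proof.
move=> ge hb.
have gg := dotv_cvg (FF := FF) ge ge.
have gh := dotv_cvg (FF := FF) ge hb.
have hh := dotv_cvg (FF := FF) hb hb.
have [e0|e0] := eqVneq e 0; last first.
  have gq : dotv (g u) (g u) `^ q @[u --> F] --> dotv e e `^ q; last exact: (cvgM gq gh).
  apply: (cvg_comp _ (fun w : R => w `^ q) gg).
  by apply: continuous_powR; rewrite dotv_gt0.
have q2 : 0 < 1 + 2 * q by move: q_gt; lra.
have gn : `|dotv (g u) (g u)| `^ (1 + 2 * q) * dotv (h u) (h u) @[u --> F] --> (0 : R).
  have gp : `|dotv (g u) (g u)| `^ (1 + 2 * q) @[u --> F] --> (0 : R).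
    rewrite -(@powR0 _ (1 + 2 * q)) ?gt_eqF// -[X in X `^ _](@normr0 _ R).
    rewrite e0 dotv0l in gg.
    apply: (cvg_comp _ (fun w : R => `|w| `^ (1 + 2 * q)) gg).
    exact: continuous_powR_norm.
  by rewrite -(mul0r (dotv b b)); exact: (cvgM gp hh).
rewrite e0 !dotv0l mulr0.
apply/cvgrPdist_lt => eps eps0.
have ev : \forall u \near F,
    `|dotv (g u) (g u)| `^ (1 + 2 * q) * dotv (h u) (h u) < eps ^+ 2.
  by apply: (cvgr_lt _ gn); rewrite exprn_gt0.
move: ev; apply: filterS => u.
rewrite sub0r normrN ger0_norm ?dotv_ge0// => H.
rewrite -ltr_sqr ?nnegrE// ?(ltW eps0)// real_normK ?num_real//.
apply: le_lt_trans H.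
have := dotv_CauchySchwarz (g u) (h u); have := dotv_ge0 (g u).
set s := dotv (g u) (g u) => s0 CS.
by rewrite powR_1D2M ?gt_eqF// exprMn -mulrA ler_wpM2l// sqr_ge0.
Qed.

(** Each term of this expanded form is continuous, also where [z.1 = 0]. *)
Lemma lyapE : lyap = fun z : X =>
  k3 ^+ 2 * dotv z.1 z.1
  + 2 * k3 * (dotv z.1 z.1 `^ q * dotv z.1 z.1)
  + `|dotv z.1 z.1| `^ (1 + 2 * q)
  - 2 * lyap_c k1 k2 * (k3 * dotv z.1 z.2 + dotv z.1 z.1 `^ q * dotv z.1 z.2)
  + (lyap_c k1 k2 ^+ 2 + lyap_d k1 k2) * dotv z.2 z.2.
Proof.
have q2 : 0 < 1 + 2 * q by move: q_gt; lra.
apply/funext => z; rewrite ger0_norm ?powR_1D2M ?dotv_ge0 ?gt_eqF//.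
by rewrite /lyap /lyap_sc; ring.
Qed.

Lemma continuous_lyap : continuous lyap.
Proof.
move=> z.
have c1 : w.1 @[w --> z] --> z.1 by exact: cvg_fst.
have c2 : w.2 @[w --> z] --> z.2 by exact: cvg_snd.
have q2 : 0 < 1 + 2 * q by move: q_gt; lra.
have ss := dotv_cvg (FF := nbhs_filter z) c1 c1.
have sb := dotv_cvg (FF := nbhs_filter z) c1 c2.
have bb := dotv_cvg (FF := nbhs_filter z) c2 c2.
rewrite lyapE.
apply: cvgD; last by apply: cvgM => //; exact: cvg_cst.
apply: cvgB; last first.
  apply: cvgM; first exact: cvg_cst.
  apply: cvgD; last exact: cvg_powR_dotv_mul.
  by apply: cvgM => //; exact: cvg_cst.
apply: cvgD; last first.
  apply: (cvg_comp _ (fun w : R => `|w| `^ (1 + 2 * q)) ss).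
  exact: continuous_powR_norm.
apply: cvgD; first by apply: cvgM => //; exact: cvg_cst.
by apply: cvgM; [exact: cvg_cst | exact: cvg_powR_dotv_mul].
Qed.

Let energy (z : X) := lyap_energy k3 q (dotv z.1 z.1) (dotv z.2 z.2).

Lemma lyap_lower_energy (z : X) : lyap_lower k1 k2 * energy z <= lyap z.
Proof.
by apply: lyap_sc_lower; rewrite ?dotv_ge0 ?dotv_CauchySchwarz.
Qed.

Lemma pos_def_lyap : pos_def lyap.
Proof.
split.
  by rewrite /lyap /lyap_sc /= !dotv0l !mulr0 subrr addr0.
move=> z z0; apply: lt_le_trans (lyap_lower_energy z).
rewrite mulr_gt0 ?lyap_lower_gt0// /energy /lyap_energy.
have [b0|b0] := eqVneq z.2 0.
  rewrite b0 dotv0l addr0 mulr_gt0 ?dotv_gt0//.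
    by rewrite exprn_gt0// ltr_wpDr// powR_ge0.
  by apply: contra_neq z0 => e0; rewrite (surjective_pairing z) e0 b0.
by rewrite ltr_wpDl ?dotv_gt0// mulr_ge0 ?dotv_ge0 ?sqr_ge0.
Qed.

Lemma lyap_ge0 (z : X) : 0 <= lyap z.
Proof.
have [V0 Vp] := pos_def_lyap.
by have [->|/Vp/ltW//] := eqVneq z 0; rewrite V0.
Qed.

(** The energy dominates both [k3^2 |e1|^2] and [|e2|^2], whence the minimum; the product norm is
    the larger of the two norms. *)
Lemma lyap_norm_lt (eps : R) (z : X) : 0 < eps ->
  lyap z < lyap_lower k1 k2 * Num.min 1 (k3 ^+ 2) * eps ^+ 2 -> `|z| < eps.
Proof.
move=> eps0 Vz; have := le_lt_trans (lyap_lower_energy z) Vz.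
rewrite -mulrA ltr_pM2l ?lyap_lower_gt0// => {Vz} Ez.
have k32 : 0 < k3 ^+ 2 by rewrite exprn_gt0.
have e2 : 0 <= eps ^+ 2 by rewrite sqr_ge0.
have Es := sqr_le_lyap_energy q k3_gt0 (dotv_ge0 z.1) (dotv_ge0 z.2).
have Eb : dotv z.2 z.2 <= energy z.
  by rewrite /energy /lyap_energy lerDr mulr_ge0 ?dotv_ge0 ?sqr_ge0.
have sqr_lt (v : 'rV[R]_n) : dotv v v < eps ^+ 2 -> `|v| < eps.
  move=> H; rewrite -ltr_sqr ?nnegrE ?(ltW eps0)//.
  exact: le_lt_trans (rV_norm_sqr_le_dotv v) H.
rewrite prod_normE gt_max; apply/andP; split; apply: sqr_lt.
  rewrite -(ltr_pM2l k32); apply: (le_lt_trans Es); apply: (lt_le_trans Ez).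
  by rewrite ler_wpM2r// ge_min lexx orbT.
apply: (le_lt_trans Eb); apply: (lt_le_trans Ez).
by rewrite -[leRHS]mul1r ler_wpM2r// ge_min lexx.
Qed.

Section Solution.
Variable x : R -> X.
Hypothesis sol : is_solution f x.

(** If [e1 = 0] and [e2 = b] is nonzero at [t], then [<e1, b>] vanishes at [t] and its derivative
    tends to [|b|^2 > 0] from the right, so it becomes positive at once. *)
Lemma solution_fst_neq0 (t : R) : 0 <= t -> x t != 0 ->
  \forall u \near t^'+, (x u).1 != 0.
Proof.
move=> t0 xt; have xr := solution_right sol t0.
have c1 : (x u).1 @[u --> t^'+] --> (x t).1.
  by apply: (cvg_comp _ _ xr); exact: cvg_fst.
have c2 : (x u).2 @[u --> t^'+] --> (x t).2.
  by apply: (cvg_comp _ _ xr); exact: cvg_snd.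
have [e0|e0] := eqVneq (x t).1 0; last first.
  have s0 : 0 < dotv (x t).1 (x t).1 by rewrite dotv_gt0.
  have ev : \forall u \near t^'+, 0 < dotv (x u).1 (x u).1.
    exact: (cvgr_gt _ (dotv_cvg c1 c1)).
  by move: ev; apply: filterS => u; rewrite dotv_gt0.
pose b := (x t).2.
have b0 : 0 < dotv b b.
  rewrite dotv_gt0; apply: contra_neq xt => b0.
  by rewrite (surjective_pairing (x t)) e0 -/b b0.
have cb : (fun=> b) u @[u --> t^'+] --> b by exact: cvg_cst.
pose y u := dotv (x u).1 b.
pose dy u := - k1 * (k3 * dotv (x u).1 b + dotv (x u).1 (x u).1 `^ q * dotv (x u).1 b)
             + dotv (x u).2 b.
(* Only times after [t] are considered, since a solution need not be differentiable at time 0. *)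
have y_dy (u : R) : t < u -> is_derive u 1 y (dy u).
  move=> tu; have u0 : 0 < u by lra.
  have dx := solution_is_derive sol u0.
  have db i : is_derive u 1 (fun v : R => (fun=> b) v 0 i) ((0 : 'rV[R]_n) 0 i).
    by rewrite mxE; exact: is_derive_cst.
  have d1 := fun i => is_derive_fst_coord i dx.
  have yd := @is_derive_dotv _ _ (fun v => (x v).1) (fun=> b) u _ _ d1 db.
  apply: (is_derive_eq yd).
  rewrite [dotv _ 0]dotvC dotv0l addr0 /f /sysf /= phi1E dotvDl !dotvZl /dy.
  by ring.
have dy_cvg : dy u @[u --> t^'+] --> dotv b b.
  have -> : dotv b b = dy t.
    by rewrite /dy e0 !dotv0l !mulr0 addr0 mulr0 add0r.
  apply: cvgD; last exact: dotv_cvg.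
  apply: cvgM; first exact: cvg_cst.
  apply: cvgD; last exact: cvg_powR_dotv_mul.
  by apply: cvgM; [exact: cvg_cst | exact: dotv_cvg].
pose m := dotv b b / 2.
have m0 : 0 < m by rewrite /m; lra.
have mb : m < dotv b b by rewrite /m; lra.
(* Monotonicity of [g] reads [y u >= m (u - t)], with half the limiting slope as [m]. *)
pose g : R -> R := m *: id - y.
have gE u : g u = m * u - y u by [].
have : \forall u \near t^'+, g u <= g t.
  apply: right_nonincreasing_near.
    apply: cvgB; last exact: dotv_cvg.
    by apply: cvgM; [exact: cvg_cst | apply: cvg_at_right_filter; exact: cvg_id].
  have ev : \forall u \near t^'+, m < dy u by exact: (cvgr_gt _ dy_cvg).
  move: ev; apply: filterS2 (nbhs_right_gt t) => u tu mu.
  have H := is_deriveB (is_deriveZ m (is_derive_id u 1)) (y_dy _ tu).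
  by split=> //; rewrite derive_val /GRing.scale/= mulr1; lra.
apply: filterS2 (nbhs_right_gt t) => u tu; rewrite !gE.
have -> : y t = 0 by rewrite /y e0 dotv0l.
rewrite subr0 => yu; apply/eqP => xu0.
by move: yu; rewrite /y xu0 dotv0l subr0 ler_pM2l// leNgt tu.
Qed.

Let W (t : R) := lyap (x t).

Lemma is_derive_lyap_solution (t : R) : 0 < t -> (x t).1 != 0 ->
  is_derive t 1 W
    (lyap_dot k1 k2 k3 q (dotv (x t).1 (x t).1) (dotv (x t).1 (x t).2)
      (dotv (x t).2 (x t).2)).
Proof.
move=> t0 e0; have dx := solution_is_derive sol t0.
have d1 := fun i => is_derive_fst_coord i dx.
have d2 := fun i => is_derive_snd_coord i dx.
apply: (@is_derive_lyap_sc _ k1 k2 k3 q k2_gt0 (fun u => dotv (x u).1 (x u).1)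
   (fun u => dotv (x u).1 (x u).2) (fun u => dotv (x u).2 (x u).2)).
- by rewrite dotv_gt0.
- apply: (is_derive_eq (is_derive_dotv d1 d1)).
  rewrite /f /sysf/= phi1E !(dotvDl, dotvDr, dotvZl, dotvZr) (dotvC (x t).2); ring.
- apply: (is_derive_eq (is_derive_dotv d1 d2)).
  rewrite /f /sysf/= phi1E phi2E !(dotvDl, dotvDr, dotvZl, dotvZr); ring.
- apply: (is_derive_eq (is_derive_dotv d2 d2)).
  rewrite /f /sysf/= phi2E !(dotvDl, dotvDr, dotvZl, dotvZr) (dotvC (x t).2); ring.
Qed.

Let l1 := lyap_l1 k1 k2 k3.
Let l2 := lyap_l2 k1 k2 q.
Let a := lyap_exp q.

Let W_right (t : R) : 0 <= t -> W u @[u --> t^'+] --> W t.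
Proof.
move=> t0; apply: (cvg_comp _ _ (solution_right sol t0)).
exact: continuous_lyap.
Qed.

Let W_left (t : R) : 0 < t -> W u @[u --> t^'-] --> W t.
Proof.
move=> t0; apply: (cvg_comp _ _ (solution_left sol t0)).
exact: continuous_lyap.
Qed.

Let W_rate (t : R) : 0 <= t -> 0 < W t ->
  \forall u \near t^'+, derivable W u 1 /\
    'D_1 W u <= - l1 * W u - l2 * W u `^ a.
Proof.
move=> t0 Wt.
have xt : x t != 0.
  by apply: contraTneq Wt => xt0; rewrite /W xt0 pos_def_lyap.1 ltxx.
have := solution_fst_neq0 t0 xt; apply: filterS2 (nbhs_right_gt t) => u tu xu.
have u0 : 0 < u by lra.
have dW := is_derive_lyap_solution u0 xu.
split=> //; rewrite derive_val.
by apply: lyap_dot_le => //; rewrite ?dotv_gt0 ?dotv_ge0 ?dotv_CauchySchwarz.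
Qed.

Let W_ge0 (t : R) : 0 <= t -> 0 <= W t.
Proof. by move=> _; exact: lyap_ge0. Qed.

Let l1_gt0 : 0 < l1. Proof. exact: lyap_l1_gt0. Qed.
Let l2_gt0 : 0 < l2. Proof. exact: lyap_l2_gt0. Qed.
Let a01 : 0 < a < 1. Proof. exact: lyap_exp01. Qed.

Lemma lyap_solution_le (t : R) : 0 <= t -> lyap (x t) <= lyap (x 0).
Proof.
exact: (fast_decay_nonincreasing l1_gt0 l2_gt0 W_ge0 W_right W_left W_rate (lexx 0)).
Qed.

Lemma lyap_solution_dini (t eps : R) : 0 <= t -> 0 < eps ->
  exists2 h0 : R, 0 < h0 & forall h : R, 0 < h < h0 ->
    (lyap (x (t + h)) - lyap (x t)) / h <=
      - l1 * lyap (x t) - l2 * lyap (x t) `^ a + eps.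
Proof.
exact: (fast_decay_dini l1_gt0 l2_gt0 a01 W_ge0 W_right W_left W_rate).
Qed.

Lemma solution_settles (t : R) :
  (l1 * (1 - a))^-1 * ln ((l1 * lyap (x 0) `^ (1 - a) + l2) / l2) <= t -> x t = 0.
Proof.
move=> /(fast_decay_settling l1_gt0 l2_gt0 a01 W_ge0 W_right W_left W_rate) Wt.
apply/eqP; apply: contraPT (Wt) => /(pos_def_lyap.2 _); rewrite /W => + Wt0.
by rewrite Wt0 ltxx.
Qed.

End Solution.

(** A sublevel set of [lyap] inside the [eps]-ball contains a ball by continuity at 0, and solutions
    cannot leave it. *)
Lemma lyap_stable_sysf : lyap_stable f.
Proof.
move=> eps eps0.
pose c := lyap_lower k1 k2 * Num.min 1 (k3 ^+ 2) * eps ^+ 2.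
have c0 : 0 < c.
  rewrite /c; apply: mulr_gt0; last by rewrite exprn_gt0.
  by rewrite mulr_gt0 ?lyap_lower_gt0// lt_min ltr01 exprn_gt0.
have V0 : lyap 0 < c by rewrite pos_def_lyap.1.
have ev : \forall z \near (0 : X), lyap z < c.
  exact: (cvgr_lt _ (@continuous_lyap 0)).
move: ev => /nbhs_norm0P[d /= d0 Hd]; exists d => // x sol x0 t t0.
apply: lyap_norm_lt => //; apply: le_lt_trans (lyap_solution_le sol t0) _.
exact: Hd.
Qed.

Lemma FFTS_sysf : FFTS f.
Proof.
split; first by rewrite /f /sysf phi1E phi2E /= !scaler0 add0r.
split; first exact: lyap_stable_sysf.
(* The estimates are global, so the radius 1 is an arbitrary choice. *)
exists 1; split=> //; exists lyap; split; first exact: continuous_lyap.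
split; first exact: pos_def_lyap.
exists (lyap_l1 k1 k2 k3), (lyap_l2 k1 k2 q), (lyap_exp q).
have l10 := lyap_l1_gt0 k1_gt0 k2_gt0 k3_gt0.
have l20 : 0 < lyap_l2 k1 k2 q by exact: lyap_l2_gt0.
have a01 : 0 < lyap_exp q < 1 by exact: lyap_exp01.
do 3!split=> //.
move=> x sol _; split; first by move=> t t0 eps; exact: lyap_solution_dini.
(* The settling time is taken equal to its bound; what remains is that this bound is nonnegative. *)
eexists; split; last by split; [exact: lexx | exact: solution_settles].
have /andP[_ a1] := a01.
apply: mulr_ge0; first by rewrite invr_ge0 mulr_ge0 ?subr_ge0 ?ltW.
apply: ln_ge0; rewrite ler_pdivlMr// mul1r lerDr mulr_ge0 ?powR_ge0//.
exact: ltW.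
Qed.

End ErrorSystem.

Unset Implicit Arguments.

Theorem theorem1 (R : realType) (n : nat) (p k1 k2 k3 : R) :
  (1 <= n)%N -> 1 < p < 2 -> 0 < k3 -> 0 < k1 -> 0 < k2 ->
  hurwitz (Astar k1 k2) ->
  FFTS (sysf n p k1 k2 k3).
Proof. by move=> _ p12 k3_gt0 k1_gt0 k2_gt0 _; exact: FFTS_sysf. Qed.
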